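(* Let $(\mathbf X_{1i},\mathbf X_{2i})$, $i=1,2,\dots$, be i.i.d. copies of $(\mathbf X_1,\mathbf X_2)$ with $P_{\mathbf X_1}\in\mathcal P_{d_1}^{\#}$ and $P_{\mathbf X_2}\in\mathcal P_{d_2}^{\#}$, and let $J_1,J_2$ be strongly regular score functions. Then for each of the five pairs of kernel functions $(f_1,f_2)$ (of order $m$) listed in (a)–(e) of the context, and for $k=1,2$, $$\frac{(n-m)!}{n!}\sum_{[i_1,\dots,i_m]\in I^n_m}\Big|f_k\big(\mathbf G^{(n)}_{k,\pm}(\mathbf X_{ki_1}),\dots,\mathbf G^{(n)}_{k,\pm}(\mathbf X_{ki_m})\big)-f_k\big(\mathbf G_{k,\pm}(\mathbf X_{ki_1}),\dots,\mathbf G_{k,\pm}(\mathbf X_{ki_m})\big)\Big|\to0\quad\text{almost surely as } n_R,n_S\to\infty.$$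
   Context: **Kernels.** For $\mathbf u,\mathbf v\ne\mathbf0$ let $\mathrm{Arc}(\mathbf u,\mathbf v)=(2\pi)^{-1}\arccos\{\mathbf u^\top\mathbf v/(\|\mathbf u\|\|\mathbf v\|)\}$, and $\mathrm{Arc}(\mathbf u,\mathbf v)=0$ otherwise; $\mathbf u\preceq\mathbf v$ means componentwise $\le$. With $\mathbf w=(\mathbf w_1,\dots,\mathbf w_m)\in(\mathbb R^{d_k})^m$: (a) $m=4$, $f_k(\mathbf w)=\frac12\|\mathbf w_1-\mathbf w_2\|$, $k=1,2$; (b) $m=5$, $f_k(\mathbf w)=\frac12\mathbf 1(\mathbf w_1\preceq\mathbf w_5\text{ and }\mathbf w_2\preceq\mathbf w_5)$, $k=1,2$; (c) $m=5$, $f_k(\mathbf w)=\frac12\mathrm{Arc}(\mathbf w_1-\mathbf w_5,\mathbf w_2-\mathbf w_5)$, $k=1,2$; (d) $m=6$, $f_1(\mathbf w)=\frac12\mathrm{Arc}(\mathbf w_1-\mathbf w_5,\mathbf w_2-\mathbf w_5)$, $f_2(\mathbf w)=\frac12\mathrm{Arc}(\mathbf w_1-\mathbf w_6,\mathbf w_2-\mathbf w_6)$; (e) $m=4$, $f_k(\mathbf w)=\mathrm{Arc}(\mathbf w_1-\mathbf w_2,\mathbf w_2-\mathbf w_3)+\mathrm{Arc}(\mathbf w_2-\mathbf w_1,\mathbf w_1-\mathbf w_4)$, $k=1,2$. $I^n_m$ is the set of all $n!/(n-m)!$ sequences of $m$ distinct elements of $\{1,\dots,n\}$. **Center-outward distribution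 functions.** $\mathcal P_d^{ac}$ is the set of probability measures on $\mathbb R^d$ absolutely continuous w.r.t. Lebesgue measure. $\mathbb S_d$ is the open unit ball and $\mathcal S_{d-1}$ the unit sphere of $\mathbb R^d$. $\mathrm U_d$ is the law of $RS$ with $R$ uniform on $[0,1)$ and $S$ uniform on $\mathcal S_{d-1}$, independent. For $P\in\mathcal P_d^{ac}$ the center-outward distribution function $\mathbf F_\pm$ is the $P$-a.s. unique map $\mathbb R^d\to\mathbb S_d$ that is the gradient of a convex function and pushes $P$ forward to $\mathrm U_d$. **Grid and sample version.** For $d\ge2$ write $n=n_Rn_S+n_0$ with $n_R,n_S\ge1$, $0\le n_0<\min\{n_R,n_S\}$. Let $\mathbf s^{(n_S)}_1,\dots,\mathbf s^{(n_S)}_{n_S}$ be distinct unit vectors (dividing the circle into equal arcs if $d=2$) whose empirical distribution converges weakly to the uniform law on $\mathcal S_{d-1}$ as $n_S\to\infty$. The grid $\mathfrak G^d_{\mathbf n}$ consists of the $n_Rn_S$ points $\frac r{n_R+1}\mathbf s_s^{(n_S)}$, $1\le r\le n_R$, $1\le s\le n_S$, plus, if $n_0\ge1$, the $n_0$ points $\frac1{2(n_R+1)}\mathbf s_s^{(n_S)}$, $s\in\mathcal S$, with $\mathcal S$ a random sample of size $n_0$ without replacement from $\{1,\dots,n_S\}$ (independent of the observations). For $d=1$: $n_S=2$, $n_R=\lfloor n/2\rfloor$, $n_0=n-2n_R$, and the grid is $\{\pm r/(n_R+1):1\le r\le n_R\}$ together with $0$ if $n_0=1$. Asymptotics are for $n\to\infty$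 with $n_R,n_S\to\infty$ (for $d=1$, $n_R\to\infty$). Given distinct points $\mathbf z_1,\dots,\mathbf z_n$, $\mathbf F^{(n)}_\pm$ is the bijection $T$ from $\{\mathbf z_i\}$ onto $\mathfrak G^d_{\mathbf n}$ minimizing $\sum_i\|\mathbf z_i-T(\mathbf z_i)\|^2$. $\mathcal P_d^{\#}$ is the class of all $P\in\mathcal P_d^{ac}$ such that, for i.i.d. $\mathbf Z_1,\dots,\mathbf Z_n\sim P$, $\max_{1\le i\le n}\|\mathbf F^{(n)}_\pm(\mathbf Z_i)-\mathbf F_\pm(\mathbf Z_i)\|\to0$ a.s. as $n_R,n_S\to\infty$. **Scores.** A score function $J:[0,1)\to[0,\infty)$ is strongly regular if it is continuous with $\int_0^1J^2(u)\,du>0$ and, moreover, Lipschitz-continuous, strictly monotone, with $J(0)=0$. $\mathbf J_k(\mathbf u)=J_k(\|\mathbf u\|)\mathbf u/\|\mathbf u\|$ for $\mathbf u\in\mathbb S_{d_k}\setminus\{\mathbf 0\}$, $\mathbf J_k(\mathbf 0)=\mathbf 0$. $\mathbf F_{k,\pm}$ is the center-outward distribution function of $\mathbf X_k$, $\mathbf F_{k,\pm}^{(n)}$ the sample version from $\{\mathbf X_{ki}\}_{i=1}^n$; $\mathbf G_{k,\pm}=\mathbf J_k\circ\mathbf F_{k,\pm}$, $\mathbf G^{(n)}_{k,\pm}=\mathbf J_k\circ\mathbf F^{(n)}_{k,\pm}$. *)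

(* Defs.v *)
From HB Require Import structures.
From mathcomp Require Import all_boot all_order all_algebra.
From mathcomp Require Import all_classical all_reals all_analysis.

Set Implicit Arguments.
Unset Strict Implicit.
Unset Printing Implicit Defensive.

Import Order.TTheory GRing.Theory Num.Theory.
Import numFieldNormedType.Exports.

Local Open Scope classical_set_scope.
Local Open Scope ring_scope.

(* 'rV[R]_d carries the product sigma-algebra of the coordinates, which is the
   Borel sigma-algebra of R^d. *)
Section measurable_rV.
Context {disp : measure_display} {T : measurableType disp} (n : nat).

Let coors : 'I_n -> 'rV[T]_n -> T := fun i x => x ord0 i.

Let rV_set0 : g_sigma_preimage coors set0.
Proof. exact: sigma_algebra0. Qed.

Let rV_setC A : g_sigma_preimage coors A -> g_sigma_preimage coors (~` A).
Proof. exact: sigma_algebraC. Qed.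

Let rV_bigcup (F : (set 'rV[T]_n)^nat) :
  (forall i, g_sigma_preimage coors (F i)) ->
  g_sigma_preimage coors (\bigcup_i F i).
Proof. exact: sigma_algebra_bigcup. Qed.

HB.instance Definition _ := @isMeasurable.Build (measure_tuple_display disp)
  'rV[T]_n (g_sigma_preimage coors) rV_set0 rV_setC rV_bigcup.

End measurable_rV.

Section euclidean.
Context {R : realType} {d : nat}.
Implicit Types u v : 'rV[R]_d.

Definition dot u v : R := \sum_(i < d) u ord0 i * v ord0 i.

(* The library norm on 'rV[R]_d is the sup norm; this is the Euclidean one. *)
Definition enorm u : R := Num.sqrt (dot u u).

Definition sphere : set 'rV[R]_d := [set u | enorm u = 1].

Definition Arc u v : R :=
  if (u != 0) && (v != 0)
  then (2 * pi)^-1 * acos (dot u v / (enorm u * enorm v)) else 0.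

Definition preceq u v : bool := [forall i, u ord0 i <= v ord0 i].

Definition box (a b : 'rV[R]_d) : set 'rV[R]_d :=
  [set x | forall i, a ord0 i <= x ord0 i <= b ord0 i].

(* Lebesgue outer measure on R^d; its restriction to the measurable sets is
   Lebesgue measure. *)
Definition lebesgue_rV (A : set 'rV[R]_d) : \bar R :=
  ereal_inf [set x | exists a b : nat -> 'rV[R]_d,
    [/\ forall k i, a k ord0 i <= b k ord0 i,
        A `<=` \bigcup_k box (a k) (b k) &
        x = (\sum_(0 <= k <oo)
               (\prod_(i < d) (b k ord0 i - a k ord0 i))%:E)%E]].

Definition abs_cont (P : probability 'rV[R]_d R) : Prop :=
  forall A, measurable A -> lebesgue_rV A = 0%E -> P A = 0%E.

(* The uniform law on the sphere is its unique rotation-invariant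
   probability. *)
Definition uniform_sphere (sigma : probability 'rV[R]_d R) : Prop :=
  sigma sphere = 1%E /\
  forall Q : 'M[R]_d, Q *m Q^T = 1%:M ->
  forall A, measurable A -> sigma ((fun x => x *m Q) @^-1` A) = sigma A.

(* The law of r s with (r, s) distributed as Unif[0,1] (x) sigma; the end point
   1 has probability 0. *)
Definition U_law (sigma : probability 'rV[R]_d R) : set 'rV[R]_d -> \bar R :=
  pushforward (uniform_prob (@ltr01 R) \x sigma)%E (fun rs => rs.1 *: rs.2).

(* F is (a version of) the center-outward distribution function of P. It is
   determined P-almost everywhere only, and so it is the gradient of phi
   P-almost everywhere. *)
Definition center_outward (P : probability 'rV[R]_d R)
    (F : 'rV[R]_d -> 'rV[R]_d) : Prop :=
  [/\ measurable_fun setT F,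
      forall x, enorm (F x) < 1,
      exists phi : 'rV[R]_d -> R,
        convex_function setT phi /\
        {ae P, forall x, differentiable phi x /\
                         forall v, 'd phi x v = dot (F x) v} &
      exists sigma, uniform_sphere sigma /\
        forall A, measurable A -> pushforward P F A = U_law sigma A].

(* Optimal assignment of the points z_i to the grid G. The minimizer is almost
   surely unique for samples from an absolutely continuous law; ties are broken
   by choice. *)
Definition empirical_cof n (z : 'I_n -> 'rV[R]_d) (G : set 'rV[R]_d) :
    'rV[R]_d -> 'rV[R]_d :=
  let cost (T : 'rV[R]_d -> 'rV[R]_d) :=
    \sum_(i < n) enorm (z i - T (z i)) ^+ 2 in
  xget (fun=> 0) [set T | set_bij (range z) G T /\
    forall T', set_bij (range z) G T' -> cost T <= cost T'].

End euclidean.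

Section grids.
Context (R : realType) (d : nat).

Record grid_design := GridDesign {
  n_R : nat -> nat;
  n_S : nat -> nat;
  n_0 : nat -> nat;
  dir : forall N, 'I_N -> 'rV[R]_d }.

Implicit Type g : grid_design.

(* Only used for d = 2. *)
Definition circle_point (t : R) : 'rV[R]_d :=
  \row_(i < d) (if i == 0%N :> nat then cos t else sin t).

Definition admissible_directions (s : forall N, 'I_N -> 'rV[R]_d) : Prop :=
  [/\ forall N, injective (s N),
      forall N j, sphere (s N j),
      d = 2%N -> forall N, (0 < N)%N -> exists t : R,
        range (s N) = [set circle_point (t + 2 * pi * j%:R / N%:R) | j in `I_N] &
      exists sigma : probability 'rV[R]_d R, uniform_sphere sigma /\
        forall f : 'rV[R]_d -> R, continuous f ->
          (exists M : R, forall x, `|f x| <= M) ->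
          (fun N : nat => N%:R^-1 * \sum_(j < N) f (s N j)) @ \oo -->
            \int[sigma]_x f x].

Definition admissible_design g : Prop :=
  if d == 1%N then
    forall n, [/\ n_S g n = 2%N, n_R g n = n./2 &
                  n_0 g n = (n - (n_R g n).*2)%N]
  else
    [/\ forall n, (0 < n)%N ->
          [/\ n = (n_R g n * n_S g n + n_0 g n)%N, (0 < n_R g n)%N,
              (0 < n_S g n)%N & (n_0 g n < minn (n_R g n) (n_S g n))%N],
        admissible_directions (@dir g),
        n_R g @ \oo --> \oo & n_S g @ \oo --> \oo].

(* The sample S of directions plays no role for d = 1. *)
Definition grid g n (S : {set 'I_(n_S g n)}) : set 'rV[R]_d :=
  let step : R := (n_R g n).+1%:R^-1 in
  if d == 1%N then
    [set x | exists2 r, (1 <= r <= n_R g n)%N &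
       x = const_mx (r%:R * step) \/ x = const_mx (- (r%:R * step))] `|`
    [set x | n_0 g n = 1%N /\ x = 0]
  else
    [set x | exists r (j : 'I_(n_S g n)), (1 <= r <= n_R g n)%N /\
       x = (r%:R * step) *: dir g j] `|`
    [set (step / 2) *: dir g j | j in [set` S]].

End grids.

Section sampling.
Context {R : realType} {disp : measure_display} {T : measurableType disp}.
Variable P : probability T R.

Definition sigma_seq {dE : measure_display} {E : measurableType dE}
    (Y : nat -> T -> E) : set (set T) :=
  <<s [set A | exists i B, measurable B /\ A = Y i @^-1` B] >>.

Definition iid {dE : measure_display} {E : measurableType dE}
    (Y : nat -> T -> E) (law : set E -> \bar R) : Prop :=
  [/\ forall i, measurable_fun setT (Y i),
      forall i A, measurable A -> P (Y i @^-1` A) = law A &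
      forall (I : seq nat) (B : nat -> set E), uniq I ->
        (forall i, measurable (B i)) ->
        P (\bigcap_(i in [set` I]) (Y i @^-1` B i)) =
        (\prod_(i <- I) P (Y i @^-1` B i))%E].

(* S n is a uniformly distributed subset of size n_0 of the n_S directions, and
   the samples (S n)_n are independent of the observations (Y i)_i. *)
Definition grid_sample {d : nat} (g : grid_design R d)
    (S : forall n, T -> {set 'I_(n_S g n)})
    {dE : measure_display} {E : measurableType dE} (Y : nat -> T -> E) : Prop :=
  (1 < d)%N ->
  [/\ forall n A, (0 < n)%N -> measurable (S n @^-1` [set A]),
      forall n A, (0 < n)%N -> P (S n @^-1` [set A]) =
        (if #|A| == n_0 g n then 'C(n_S g n, n_0 g n)%:R^-1 else 0)%:E &
      forall A B,
        <<s [set C | exists n (D : set {set 'I_(n_S g n)}),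
                      (0 < n)%N /\ C = S n @^-1` D] >> A ->
        sigma_seq Y B -> P (A `&` B) = (P A * P B)%E].

End sampling.

Definition sample_cof {R : realType} {d : nat} (g : grid_design R d)
    {T : Type} (S : forall n, T -> {set 'I_(n_S g n)})
    (Z : nat -> T -> 'rV[R]_d) (n : nat) (w : T) : 'rV[R]_d -> 'rV[R]_d :=
  empirical_cof (fun i : 'I_n => Z i w) (grid (S n w)).

(* The class P_d^#, relative to the sequence of grids fixed by g. *)
Definition P_sharp {R : realType} {d : nat} (g : grid_design R d)
    (mu : probability 'rV[R]_d R) : Prop :=
  abs_cont mu /\
  forall F, center_outward mu F ->
  forall (disp : measure_display) (T : measurableType disp)
    (P : probability T R) (Z : nat -> T -> 'rV[R]_d)
    (S : forall n, T -> {set 'I_(n_S g n)}),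
  iid P Z mu -> grid_sample P S Z ->
  {ae P, forall w,
    (fun n : nat => \big[Num.max/0]_(i < n)
       enorm (sample_cof S Z n w (Z i w) - F (Z i w))) @ \oo --> (0 : R)}.

Section scores.
Context {R : realType}.

Definition strongly_regular (J : R -> R) : Prop :=
  [/\ {in `[0, 1[, forall x, 0 <= J x},
      {within `[0, 1[, continuous J},
      (0 < \int[lebesgue_measure]_(x in `[0%R, 1%R[) ((J x) ^+ 2)%:E)%E,
      [lipschitz J x | x in `[0, 1[] &
      ({in `[0, 1[ &, {homo J : x y / x < y}} \/
       {in `[0, 1[ &, {homo J : x y /~ x < y}}) /\ J 0 = 0].

Definition score_vec {d : nat} (J : R -> R) (u : 'rV[R]_d) : 'rV[R]_d :=
  if u == 0 then 0 else (J (enorm u) / enorm u) *: u.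

End scores.

(* (a) distance covariance; (b), (c) Hoeffding's D, marginal ordering and
   projection averaging; (d) Blum-Kiefer-Rosenblatt's R; (e)
   Bergsma-Dassios-Yanagimoto's tau*. *)
Inductive kernel_pair :=
  | DistCov | HoeffdingM | HoeffdingP | BlumKieferRosenblatt | BergsmaDassios.

Definition kernel_order (c : kernel_pair) : nat :=
  match c with
  | DistCov => 4 | HoeffdingM => 5 | HoeffdingP => 5
  | BlumKieferRosenblatt => 6 | BergsmaDassios => 4
  end.

(* w`_j is the (j+1)-st argument w_(j+1). *)
Definition kernel1 {R : realType} (c : kernel_pair) {d : nat}
    (w : (kernel_order c).-tuple 'rV[R]_d) : R :=
  match c with
  | DistCov => 2^-1 * enorm (w`_0 - w`_1)
  | HoeffdingM => 2^-1 * (preceq w`_0 w`_4 && preceq w`_1 w`_4)%:R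
  | HoeffdingP => 2^-1 * Arc (w`_0 - w`_4) (w`_1 - w`_4)
  | BlumKieferRosenblatt => 2^-1 * Arc (w`_0 - w`_4) (w`_1 - w`_4)
  | BergsmaDassios =>
      Arc (w`_0 - w`_1) (w`_1 - w`_2) + Arc (w`_1 - w`_0) (w`_0 - w`_3)
  end.

Definition kernel2 {R : realType} (c : kernel_pair) {d : nat}
    (w : (kernel_order c).-tuple 'rV[R]_d) : R :=
  match c with
  | BlumKieferRosenblatt => 2^-1 * Arc (w`_0 - w`_5) (w`_1 - w`_5)
  | _ => kernel1 w
  end.

(* Average over all sequences of m distinct indices of |f(a_i) - f(b_i)|. *)
Definition avg_kernel_diff {R : realType} {V : Type} {m n : nat}
    (f : m.-tuple V -> R) (a b : 'I_n -> V) : R :=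
  (n - m)`!%:R / n`!%:R *
  \sum_(i : m.-tuple 'I_n | uniq i) `|f (map_tuple a i) - f (map_tuple b i)|.

(* Main.v *)
Require Import Defs.
From HB Require Import structures.
From mathcomp Require Import all_boot all_order all_algebra finmap.
From mathcomp Require Import all_classical all_reals all_analysis.
From mathcomp Require Import measurable_realfun ring lra zify.

Set Implicit Arguments.
Unset Strict Implicit.
Unset Printing Implicit Defensive.

Import Order.TTheory GRing.Theory Num.Theory.
Import numFieldNormedType.Exports.

Local Open Scope classical_set_scope.
Local Open Scope ring_scope.

(* Every kernel is uniformly continuous at tuples whose entries
   are pairwise separated in each coordinate: the indicator of (b) jumps only
   when two coordinates coincide, and Arc only when a difference vanishes. Since
   the scores are Lipschitz on the unit ball, G^(n) - G tends to 0 uniformly over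
   the sample, so it remains to see that few tuples have nearly coinciding
   coordinates. The law of each coordinate of G(X) = J(R) S has no atoms, because
   J is injective and the uniform law on the sphere does not charge coordinate
   hyperplanes. By compactness, the range is covered by finitely many intervals
   of arbitrarily small probability, and a union bound together with
   Borel-Cantelli shows that almost surely each of them eventually contains at
   most n / K of the first n observations. *)

(** * Euclidean norm, scores and grids *)

Section euclidean_norm.
Context {R : realType} {d : nat}.
Implicit Types u v w : 'rV[R]_d.

Lemma dotC u v : dot u v = dot v u.
Proof. by apply: eq_bigr => i _; rewrite mulrC. Qed.

Lemma dotDl u v w : dot (u + v) w = dot u w + dot v w.
Proof. by rewrite -big_split; apply: eq_bigr => i _; rewrite mxE mulrDl. Qed.

Lemma dotZl a u v : dot (a *: u) v = a * dot u v.
Proof. by rewrite mulr_sumr; apply: eq_bigr => i _; rewrite mxE mulrA. Qed.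

Lemma dotDr u v w : dot u (v + w) = dot u v + dot u w.
Proof. by rewrite dotC dotDl !(dotC u). Qed.

Lemma dotZr a u v : dot u (a *: v) = a * dot u v.
Proof. by rewrite dotC dotZl (dotC u). Qed.

Lemma dotNl u v : dot (- u) v = - dot u v.
Proof. by rewrite -scaleN1r dotZl mulN1r. Qed.

Lemma dotNr u v : dot u (- v) = - dot u v.
Proof. by rewrite dotC dotNl dotC. Qed.

Lemma dot_ge0 u : 0 <= dot u u.
Proof. by apply: sumr_ge0 => i _; rewrite -expr2 sqr_ge0. Qed.

Lemma dot_eq0 u : (dot u u == 0) = (u == 0).
Proof.
apply/idP/eqP => [|->]; last first.
  by rewrite /dot big1// => i _; rewrite mxE mul0r.
rewrite psumr_eq0 => [/allP h|i _]; last by rewrite -expr2 sqr_ge0.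
apply/rowP => i; rewrite mxE; apply/eqP.
by have := h i (mem_index_enum i); rewrite -expr2 sqrf_eq0.
Qed.

Lemma enorm_ge0 u : 0 <= enorm u.
Proof. exact: sqrtr_ge0. Qed.

Lemma sqr_enorm u : enorm u ^+ 2 = dot u u.
Proof. by rewrite sqr_sqrtr ?dot_ge0. Qed.

Lemma enorm_eq0 u : (enorm u == 0) = (u == 0).
Proof. by rewrite -dot_eq0 -sqr_enorm sqrf_eq0. Qed.

Lemma enorm_gt0 u : (0 < enorm u) = (u != 0).
Proof. by rewrite lt_def enorm_ge0 andbT enorm_eq0. Qed.

Lemma enorm0 : enorm (0 : 'rV[R]_d) = 0.
Proof. by apply/eqP; rewrite enorm_eq0. Qed.

Lemma enormZ a u : enorm (a *: u) = `|a| * enorm u.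
Proof.
by rewrite /enorm dotZl dotZr mulrA -expr2 sqrtrM ?sqr_ge0// sqrtr_sqr.
Qed.

Lemma enormN u : enorm (- u) = enorm u.
Proof. by rewrite -scaleN1r enormZ normrN1 mul1r. Qed.

Lemma enorm_distrC u v : enorm (u - v) = enorm (v - u).
Proof. by rewrite -opprB enormN. Qed.

(** Cauchy-Schwarz: the squared norm of [dot v v *: u - dot u v *: v] is [dot v v] times the
    difference of the squared sides. *)
Lemma dot_le_enorm u v : `|dot u v| <= enorm u * enorm v.
Proof.
have [->|v0] := eqVneq v 0.
  rewrite enorm0 mulr0 /dot big1 ?normr0// => i _; by rewrite mxE mulr0.
have vp : 0 < dot v v by rewrite lt_def dot_eq0 v0 dot_ge0.
rewrite -(ler_pXn2r (n := 2)) ?nnegrE ?mulr_ge0 ?enorm_ge0 ?normr_ge0//.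
rewrite exprMn !sqr_enorm real_normK ?num_real//.
have := dot_ge0 (dot v v *: u - dot u v *: v).
rewrite !(dotDl, dotDr, dotNl, dotNr, dotZl, dotZr) (dotC v u) => h.
rewrite -subr_ge0 -(pmulr_rge0 _ vp); apply: le_trans h _.
by rewrite le_eqVlt; apply/orP; left; apply/eqP; ring.
Qed.

Lemma enorm_triangle u v : enorm (u + v) <= enorm u + enorm v.
Proof.
rewrite -(ler_pXn2r (n := 2)) ?nnegrE ?addr_ge0 ?enorm_ge0//.
rewrite sqrrD !sqr_enorm dotDl !dotDr (dotC v u).
have := le_trans (ler_norm _) (dot_le_enorm u v).
by lra.
Qed.

Lemma enorm_lip u v : `|enorm u - enorm v| <= enorm (u - v).
Proof.
have := enorm_triangle (u - v) v; have := enorm_triangle (v - u) u.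
rewrite !subrK enorm_distrC ler_norml => ? ?; apply/andP; split; lra.
Qed.

Lemma coord_le_enorm u i : `|u ord0 i| <= enorm u.
Proof.
rewrite -sqrtr_sqr ler_sqrt ?dot_ge0// expr2 /dot (bigD1 i)//= lerDl.
by apply: sumr_ge0 => j _; rewrite -expr2 sqr_ge0.
Qed.

Lemma enorm_normalize_le1 u : enorm ((enorm u)^-1 *: u) <= 1.
Proof.
rewrite enormZ normfV (ger0_norm (enorm_ge0 u)).
have [->|u0] := eqVneq u 0; first by rewrite enorm0 mulr0 ler01.
by rewrite mulVf// enorm_eq0.
Qed.

(** After multiplication by [enorm v], the difference splits into a radial correction and [u - v],
    each of norm at most [enorm (u - v)]. For [u = 0] the normalized vector is 0. *)
Lemma enorm_normalize_lip u v : v != 0 ->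
  enorm ((enorm u)^-1 *: u - (enorm v)^-1 *: v) <= 2 * enorm (u - v) / enorm v.
Proof.
move=> v0; have vp : 0 < enorm v by rewrite enorm_gt0.
rewrite ler_pdivlMr// -[X in _ * X](gtr0_norm vp) mulrC -enormZ.
rewrite scalerBr !scalerA divff ?gt_eqF// scale1r.
have -> : (enorm v / enorm u) *: u - v =
    ((enorm v - enorm u) / enorm u) *: u + (u - v).
  have [->|u0] := eqVneq u 0; first by rewrite !scaler0 !add0r.
  rewrite mulrBl divff ?enorm_eq0// scalerBl scale1r addrA subrK//.
have -> : 2 * enorm (u - v) = enorm (u - v) + enorm (u - v) by ring.
apply: le_trans (enorm_triangle _ _) _.
rewrite lerD2r enormZ normrM normfV (ger0_norm (enorm_ge0 u)).
have [->|u0] := eqVneq u 0; first by rewrite !enorm0 mulr0 enorm_ge0.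
by rewrite divfK ?enorm_eq0// enorm_distrC enorm_lip.
Qed.

Lemma score_vecE (J : R -> R) u : score_vec J u = (J (enorm u) / enorm u) *: u.
Proof. by rewrite /score_vec; case: eqP => // ->; rewrite scaler0. Qed.

(** Changing the radius costs [L]. Changing the direction costs [2 * L]: normalization is not
    Lipschitz near 0, but [J 0 = 0] gives [J (enorm v)] a size of at most [L * enorm v], which
    cancels the factor [(enorm v)^-1]. *)
Lemma score_vec_lip (J : R -> R) (L : R) u v : 0 <= L -> J 0 = 0 ->
  (forall x y, 0 <= x < 1 -> 0 <= y < 1 -> `|J x - J y| <= L * `|x - y|) ->
  enorm u < 1 -> enorm v < 1 ->
  enorm (score_vec J u - score_vec J v) <= 3 * L * enorm (u - v).
Proof.
move=> L0 J0 JL u1 v1.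
have u01 : 0 <= enorm u < 1 by rewrite enorm_ge0.
have v01 : 0 <= enorm v < 1 by rewrite enorm_ge0.
have Jle x : 0 <= x < 1 -> `|J x| <= L * x.
  move=> x01; have := JL x 0 x01; rewrite J0 !subr0 lexx ltr01 => /(_ isT).
  by case/andP: x01 => /ger0_norm ->.
have normalized_le1 := enorm_normalize_le1 u.
rewrite !score_vecE -!scalerA.
have [->|v0] := eqVneq v 0.
  rewrite !scaler0 !subr0 enormZ.
  apply: (@le_trans _ _ (L * enorm u * 1)).
    by apply: ler_pM; rewrite ?normr_ge0 ?enorm_ge0 ?Jle.
  rewrite mulr1 ler_wpM2r ?enorm_ge0//; lra.
set u' := _ *: u in normalized_le1 *; set v' := _ *: v.
have -> : J (enorm u) *: u' - J (enorm v) *: v' =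
    (J (enorm u) - J (enorm v)) *: u' + J (enorm v) *: (u' - v').
  by rewrite scalerBl scalerBr addrA subrK.
apply: le_trans (enorm_triangle _ _) _; rewrite (enormZ _ u') (enormZ _ (u' - v')).
have h1 : `|J (enorm u) - J (enorm v)| * enorm u' <= L * enorm (u - v) * 1.
  apply: ler_pM; rewrite ?normr_ge0 ?enorm_ge0//.
  by apply: le_trans (JL _ _ u01 v01) _; rewrite ler_wpM2l// enorm_lip.
have h2 : `|J (enorm v)| * enorm (u' - v') <=
    L * enorm v * (2 * enorm (u - v) / enorm v).
  by apply: ler_pM; rewrite ?normr_ge0 ?enorm_ge0 ?Jle// enorm_normalize_lip.
apply: le_trans (lerD h1 h2) _.
have -> : L * enorm v * (2 * enorm (u - v) / enorm v) = 2 * L * enorm (u - v).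
  by field; rewrite enorm_eq0.
lra.
Qed.

End euclidean_norm.

Lemma strongly_regular_lip (R : realType) (J : R -> R) : strongly_regular J ->
  exists2 L : R, 0 < L &
    forall x y, 0 <= x < 1 -> 0 <= y < 1 -> `|J x - J y| <= L * `|x - y|.
Proof.
case=> _ _ _ hlip _.
have [L [L0 hL]] : exists L : R, 0 < L /\
    forall p : R * R, (`[0%R, 1%R[ `*` `[0%R, 1%R[) p ->
      `|J p.1 - J p.2| <= L * `|p.1 - p.2|.
  near (+oo : set_system R) => L; exists L; split => //.
  have : L.-lipschitz_`[0%R, 1%R[ J by near: L; exact: hlip.
  by move=> h p hp; exact: (h p hp).
exists L => // x y x01 y01; apply: (hL (x, y)).
by split; rewrite /= in_itv.
Unshelve. all: by end_near. Qed.

Lemma strongly_regular_inj (R : realType) (J : R -> R) (x y : R) :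
  strongly_regular J -> 0 <= x < 1 -> 0 <= y < 1 -> J x = J y -> x = y.
Proof.
case=> _ _ _ _ [Jm _] x01 y01 Jxy.
have xI : x \in `[0, 1[ by rewrite in_itv.
have yI : y \in `[0, 1[ by rewrite in_itv.
have [xy|yx|//] := ltgtP x y.
- by case: Jm => h; have := h _ _ xI yI; have := h _ _ yI xI;
    rewrite Jxy ltxx => h1 h2; [have := h2 xy|have := h1 xy].
- by case: Jm => h; have := h _ _ xI yI; have := h _ _ yI xI;
    rewrite Jxy ltxx => h1 h2; [have := h1 yx|have := h2 yx].
Qed.

Section grid_norm.
Context {R : realType} {d : nat}.
Implicit Types g : grid_design R d.

Lemma enorm_const_mx1 (a : R) : d = 1%N -> enorm (const_mx a : 'rV_d) = `|a|.
Proof.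
move=> d1; subst d; rewrite /enorm /dot big_ord_recl big_ord0 addr0 !mxE.
by rewrite -expr2 sqrtr_sqr.
Qed.

Lemma grid_enorm_lt1 g n (S : {set 'I_(n_S g n)}) x : (0 < n)%N ->
  admissible_design g -> grid S x -> enorm x < 1.
Proof.
move=> n0; rewrite /admissible_design /grid.
have step_lt1 r : (r <= n_R g n)%N -> `|r%:R * (n_R g n).+1%:R^-1| < 1 :> R.
  move=> rn; rewrite ger0_norm ?mulr_ge0 ?invr_ge0//.
  by rewrite ltr_pdivrMr ?ltr0n// mul1r ltr_nat ltnS.
case: eqP => [d1 _|_ [_ [_ dirS _ _] _ _]].
  case=> [[r /andP[_ rn] [] ->]|[_ ->]].
  - by rewrite enorm_const_mx1// step_lt1.
  - by rewrite enorm_const_mx1// normrN step_lt1.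
  - by rewrite enorm0 ltr01.
case=> [[r [j [/andP[_ rn] ->]]]|[j _ <-]].
  by rewrite enormZ dirS mulr1 step_lt1.
rewrite enormZ dirS mulr1 ger0_norm; last by rewrite divr_ge0 ?invr_ge0.
have : (n_R g n).+1%:R^-1 <= 1 :> R.
  by rewrite invf_le1 ?ltr0n// ler1n.
by move: _^-1 => a; lra.
Qed.

(** An optimal assignment takes its values in the grid; if there is none, [xget] returns the zero
    map, which obeys the same bound. *)
Lemma sample_cof_enorm_lt1 g (T : Type) (S : forall n, T -> {set 'I_(n_S g n)})
    (Z : nat -> T -> 'rV[R]_d) n w i :
  admissible_design g -> (i < n)%N -> enorm (sample_cof S Z n w (Z i w)) < 1.
Proof.
move=> ag lin; rewrite /sample_cof /empirical_cof; case: xgetP => [y yE [bij _]|_].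
  apply: (grid_enorm_lt1 (S := S n w)); rewrite ?(leq_trans _ lin)//.
  by case: bij => fG _ _; apply: fG; exists (Ordinal lin).
by rewrite enorm0 ltr01.
Qed.

End grid_norm.

(** * Continuity of the kernels *)

Section arccos_uniform.
Context {R : realType}.
Implicit Types a b : R.

(* For [b <= a] the product [sin (acos a) * sin (acos b)] is at least
   [(1 - a) * (1 + b)], whence [1 - cos (acos a - acos b) <= a - b]. *)
Lemma one_sub_cos_acosB a b : -1 <= a <= 1 -> -1 <= b <= 1 ->
  1 - cos (acos a - acos b) <= `|a - b|.
Proof.
wlog ba : a b / b <= a => [hw aI bI|].
  have [ba|/ltW ab] := leP b a; first exact: hw.
  by rewrite -cosN opprB distrC; exact: hw.
move=> aI bI; rewrite cosB !acosK ?in_itv// !sin_acos//.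
rewrite ger0_norm ?subr_ge0// -sqrtrM; last by case/andP: aI => ? ?; nra.
case/andP: aI bI => a1 a2 /andP[b1 b2].
have : (1 - a) * (1 + b) <= Num.sqrt ((1 - a ^+ 2) * (1 - b ^+ 2)).
  rewrite -[leLHS]ger0_norm -?sqrtr_sqr; last by apply: mulr_ge0; lra.
  rewrite ler_sqrt; last by apply: mulr_ge0; nra.
  have -> : (1 - a ^+ 2) * (1 - b ^+ 2) =
    ((1 - a) * (1 + b)) * ((1 + a) * (1 - b)) by ring.
  rewrite expr2 ler_wpM2l ?mulr_ge0//; [lra|lra|nra].
lra.
Qed.

(** The previous bound controls [1 - cos] of the difference, and [cos] decreases on [[0, pi]].
    Capping [eta] by [pi] keeps [e] in that interval, whence [kappa = 1 - cos e]. *)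
Lemma acos_uniform_continuity (eta : R) : 0 < eta ->
  exists2 kappa : R, 0 < kappa & forall a b, -1 <= a <= 1 -> -1 <= b <= 1 ->
    `|a - b| <= kappa -> `|acos a - acos b| <= eta.
Proof.
move=> eta0; pose e := Num.min eta pi.
have e0 : 0 < e by rewrite lt_min eta0 pi_gt0.
have epi : e <= pi by rewrite ge_min lexx orbT.
have eI : e \in `[0, pi] by rewrite in_itv/= (ltW e0).
exists (1 - cos e).
  rewrite subr_gt0 -cos0 ltr_cos// in_itv/= lexx pi_ge0//.
move=> a b aI bI abk; apply: (@le_trans _ _ e); last by rewrite ge_min lexx.
have := le_trans (one_sub_cos_acosB aI bI) abk.
rewrite lerD2l lerN2 -(cos_norm (acos a - _)) => h.
have tI : `|acos a - acos b| \in `[0, pi].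
  rewrite in_itv/= normr_ge0/= ler_norml.
  have := acos_ge0 aI; have := acos_lepi aI.
  have := acos_ge0 bI; have := acos_lepi bI.
  by move=> ? ? ? ?; apply/andP; split; lra.
by rewrite leNgt -ltr_cos// -leNgt.
Qed.

End arccos_uniform.

Section arc.
Context {R : realType} {d : nat}.
Implicit Types u v : 'rV[R]_d.

Let normalize u := (enorm u)^-1 *: u.

Let cosineE u v : dot u v / (enorm u * enorm v) =
  dot (normalize u) (normalize v).
Proof. by rewrite dotZl dotZr invfM; ring. Qed.

Let cosineI u v : -1 <= dot (normalize u) (normalize v) <= 1.
Proof.
rewrite -ler_norml (le_trans (dot_le_enorm _ _))// -[leRHS]mulr1.
by rewrite ler_pM ?enorm_ge0// enorm_normalize_le1.
Qed.

Lemma Arc_ge0_le1 u v : 0 <= Arc u v <= 1.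
Proof.
rewrite /Arc; case: ifP => _; last by rewrite lexx ler01.
rewrite cosineE; have h := cosineI u v.
have := acos_ge0 h; have := acos_lepi h; have := pi_gt0 R => p0 a1 a0.
rewrite mulr_ge0 ?invr_ge0//; last by apply: mulr_ge0; lra.
by rewrite mulrC ler_pdivrMr; [lra|apply: mulr_gt0; lra].
Qed.

(** Only [u'] and [v'] are kept away from 0. A perturbation of at most [delta] leaves [u] and [v]
    nonzero, and one of at most [kappa * delta / 4] moves each normalized vector by at most
    [kappa / 2], hence the cosine by at most [kappa]. *)
Lemma Arc_uniform_continuity (eta delta : R) : 0 < eta -> 0 < delta ->
  exists2 eps : R, 0 < eps & forall u u' v v', delta < enorm u' ->
    delta < enorm v' -> enorm (u - u') <= eps -> enorm (v - v') <= eps ->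
    `|Arc u v - Arc u' v'| <= eta.
Proof.
move=> eta0 delta0; have [kappa kappa0 hk] := acos_uniform_continuity eta0.
have eps0 : 0 < Num.min delta (kappa * delta / 4).
  by rewrite lt_min delta0/= divr_gt0// mulr_gt0.
exists (Num.min delta (kappa * delta / 4)) => // u u' v v' hu' hv'.
rewrite !le_min => /andP[hu1 hu2] /andP[hv1 hv2].
have nz (x x' : 'rV[R]_d) : delta < enorm x' -> enorm (x - x') <= delta ->
    x' != 0 /\ x != 0.
  move=> dx' dxx'; split; first by rewrite -enorm_gt0 (lt_trans delta0).
  apply/eqP => x0; move: dxx'; rewrite x0 sub0r enormN.
  by move=> /(lt_le_trans dx'); rewrite ltxx.
have [u'0 u0] := nz _ _ hu' hu1; have [v'0 v0] := nz _ _ hv' hv1.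
have close (x x' : 'rV[R]_d) : delta < enorm x' ->
    enorm (x - x') <= kappa * delta / 4 ->
    enorm (normalize x - normalize x') <= kappa / 2.
  move=> dx' dxx'; have x'p : 0 < enorm x' := lt_trans delta0 dx'.
  have x'0 : x' != 0 by rewrite -enorm_gt0.
  apply: le_trans (enorm_normalize_lip _ x'0) _.
  by rewrite ler_pdivrMr//; nra.
have hu := close _ _ hu' hu2; have hv := close _ _ hv' hv2.
rewrite /Arc u0 v0 u'0 v'0 /= !cosineE -mulrBr normrM ger0_norm; last first.
  by rewrite invr_ge0 mulr_ge0// pi_ge0.
rewrite mulrC ler_pdivrMr ?mulr_gt0 ?pi_gt0//.
apply: (@le_trans _ _ eta); last first.
  by rewrite ler_peMr ?(ltW eta0)//; have := pi_ge2 R; lra.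
apply: hk; [exact: cosineI|exact: cosineI|].
set a := normalize u; set a' := normalize u'.
set b := normalize v; set b' := normalize v'.
have -> : dot a b - dot a' b' = dot (a - a') b + dot a' (b - b').
  by rewrite dotDl dotDr dotNl dotNr addrA subrK.
apply: le_trans (ler_normD _ _) _; rewrite [leRHS](splitr kappa).
apply: lerD; apply: le_trans (dot_le_enorm _ _) _.
  by rewrite -[leRHS]mulr1 ler_pM ?enorm_ge0// enorm_normalize_le1.
by rewrite -[leRHS]mul1r ler_pM ?enorm_ge0// enorm_normalize_le1.
Qed.

End arc.

Section stable_kernels.
Context {R : realType} {d : nat}.

(** Separation is asked of [y] alone, which will hold the population scores. The crude bound [M],
    chosen before [eta] and [delta], serves for the few tuples that are not separated. *)
Definition stable_kernel {m} (f : m.-tuple 'rV[R]_d -> R) : Prop :=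
  exists2 M : R, 0 <= M & forall eta delta : R, 0 < eta -> 0 < delta ->
  exists2 eps : R, 0 < eps & forall x y : m.-tuple 'rV[R]_d,
    (forall j : 'I_m, enorm (x`_j - y`_j) <= eps) ->
    `|f x - f y| <= M /\
    ((forall (p q : 'I_m) i, p != q ->
        delta < `|y`_p ord0 i - y`_q ord0 i|) -> `|f x - f y| <= eta).

Lemma stable_kernelD m (f g : m.-tuple 'rV[R]_d -> R) :
  stable_kernel f -> stable_kernel g -> stable_kernel (fun w => f w + g w).
Proof.
move=> [M M0 hf] [N N0 hg]; exists (M + N); first exact: addr_ge0.
move=> eta delta eta0 delta0; have eta20 : 0 < eta / 2 by lra.
have [e e0 he] := hf _ _ eta20 delta0; have [k k0 hk] := hg _ _ eta20 delta0.
exists (Num.min e k); first by rewrite lt_min e0.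
move=> x y xy; rewrite opprD addrACA.
have [|fM feta] := he x y; first by move=> j; have := xy j; rewrite le_min => /andP[].
have [|gN geta] := hk x y; first by move=> j; have := xy j; rewrite le_min => /andP[].
split; first by rewrite (le_trans (ler_normD _ _))// lerD.
by move=> sep; rewrite (le_trans (ler_normD _ _))// [leRHS]splitr lerD ?feta ?geta.
Qed.

Lemma stable_kernelZ m c (f : m.-tuple 'rV[R]_d -> R) :
  stable_kernel f -> stable_kernel (fun w => c * f w).
Proof.
move=> [M M0 hf]; exists (`|c| * M); first exact: mulr_ge0.
move=> eta delta eta0 delta0.
have c0 : 0 < `|c| + 1 by rewrite ltr_wpDl.
have eta'0 : 0 < eta / (`|c| + 1) by rewrite divr_gt0.
have [e e0 he] := hf _ _ eta'0 delta0; exists e => // x y xy.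
rewrite -mulrBr normrM; have [fM feta] := he x y xy.
split; first by rewrite ler_wpM2l.
move=> /feta; rewrite ler_pdivlMr// => h.
by rewrite (le_trans _ h)// mulrC ler_wpM2l// lerDl.
Qed.

Lemma stable_kernel_dist m (p q : 'I_m) :
  stable_kernel (fun w : m.-tuple 'rV[R]_d => enorm (w`_p - w`_q)).
Proof.
(* The cap 1 on the perturbation yields the bound 2, although distances themselves are not
   bounded. *)
exists 2 => // eta delta eta0 delta0; exists (Num.min 1 (eta / 2)).
  by rewrite lt_min ltr01; lra.
move=> x y xy; have := xy p; have := xy q.
rewrite !le_min => /andP[q1 q2] /andP[p1 p2].
have : `|enorm (x`_p - x`_q) - enorm (y`_p - y`_q)| <=
    enorm (x`_p - y`_p) + enorm (x`_q - y`_q).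
  rewrite (le_trans (enorm_lip _ _))// -(enormN (x`_q - _)).
  have -> : x`_p - x`_q - (y`_p - y`_q) = x`_p - y`_p + - (x`_q - y`_q).
    by rewrite !opprD !opprK addrACA.
  exact: enorm_triangle.
by move=> h; split => [|_]; apply: le_trans h _; lra.
Qed.

Lemma stable_kernel_Arc (hd : (0 < d)%N) m (p q r s : 'I_m) :
  p != r -> q != s ->
  stable_kernel (fun w : m.-tuple 'rV[R]_d => Arc (w`_p - w`_r) (w`_q - w`_s)).
Proof.
move=> pr qs; exists 1 => // eta delta eta0 delta0.
have [e e0 he] := Arc_uniform_continuity (d := d) eta0 delta0.
exists (e / 2); first lra.
move=> x y xy; split.
  have := Arc_ge0_le1 (x`_p - x`_r) (x`_q - x`_s).
  have := Arc_ge0_le1 (y`_p - y`_r) (y`_q - y`_s).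
  by move=> /andP[? ?] /andP[? ?]; rewrite ler_norml; apply/andP; split; lra.
move=> sep.
(* Separation in a single coordinate, which [hd] provides, already separates in norm. *)
have far (i j : 'I_m) : i != j -> delta < enorm (y`_i - y`_j).
  move=> /(sep i j (Ordinal hd)) /lt_le_trans; apply.
  by apply: le_trans (coord_le_enorm _ (Ordinal hd)); rewrite !mxE.
have close (i j : 'I_m) : enorm (x`_i - x`_j - (y`_i - y`_j)) <= e.
  have -> : x`_i - x`_j - (y`_i - y`_j) = x`_i - y`_i + - (x`_j - y`_j).
    by rewrite !opprD !opprK addrACA.
  rewrite (le_trans (enorm_triangle _ _))// enormN.
  by have := xy i; have := xy j; lra.
by apply: he; rewrite ?far ?close.
Qed.

(** Two coordinates more than [delta] apart keep their order when each moves by at most [delta / 2],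
    so the indicator does not change at all. *)
Lemma stable_kernel_preceq m (p q r s : 'I_m) : p != r -> q != s ->
  stable_kernel (fun w : m.-tuple 'rV[R]_d =>
    (preceq w`_p w`_r && preceq w`_q w`_s)%:R).
Proof.
move=> pr qs; exists 1 => // eta delta eta0 delta0.
exists (delta / 2); first lra.
move=> x y xy; split.
  by do 2!case: (_ && _) => /=;
    rewrite ?subrr ?subr0 ?sub0r ?normrN ?normr1 ?normr0 ?ler01 ?lexx.
move=> sep.
have same (i j : 'I_m) : i != j -> preceq x`_i x`_j = preceq y`_i y`_j.
  move=> ij; apply: eq_forallb => k; have := sep _ _ k ij.
  have := le_trans (coord_le_enorm _ k) (xy i).
  have := le_trans (coord_le_enorm _ k) (xy j).
  rewrite !mxE !ler_norml lter_normr.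
  move=> /andP[? ?] /andP[? ?] /orP[]?; apply/idP/idP => ?; lra.
by rewrite !same// subrr normr0 ltW.
Qed.

Lemma stable_kernel1 (c : kernel_pair) : (0 < d)%N ->
  stable_kernel (@kernel1 R c d).
Proof.
move=> hd; case: c.
- apply: stable_kernelZ.
  exact: (@stable_kernel_dist 4 (@Ordinal 4 0 isT) (@Ordinal 4 1 isT)).
- apply: stable_kernelZ.
  by apply: (@stable_kernel_preceq 5 (@Ordinal 5 0 isT) (@Ordinal 5 1 isT)
    (@Ordinal 5 4 isT) (@Ordinal 5 4 isT)).
- apply: stable_kernelZ.
  by apply: (@stable_kernel_Arc hd 5 (@Ordinal 5 0 isT) (@Ordinal 5 1 isT)
    (@Ordinal 5 4 isT) (@Ordinal 5 4 isT)).
- apply: stable_kernelZ.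
  by apply: (@stable_kernel_Arc hd 6 (@Ordinal 6 0 isT) (@Ordinal 6 1 isT)
    (@Ordinal 6 4 isT) (@Ordinal 6 4 isT)).
- apply: stable_kernelD.
    by apply: (@stable_kernel_Arc hd 4 (@Ordinal 4 0 isT) (@Ordinal 4 1 isT)
      (@Ordinal 4 1 isT) (@Ordinal 4 2 isT)).
  by apply: (@stable_kernel_Arc hd 4 (@Ordinal 4 1 isT) (@Ordinal 4 0 isT)
    (@Ordinal 4 0 isT) (@Ordinal 4 3 isT)).
Qed.

Lemma stable_kernel2 (c : kernel_pair) : (0 < d)%N ->
  stable_kernel (@kernel2 R c d).
Proof.
move=> hd; case: c; try exact: stable_kernel1.
apply: stable_kernelZ.
by apply: (@stable_kernel_Arc hd 6 (@Ordinal 6 0 isT) (@Ordinal 6 1 isT)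
  (@Ordinal 6 5 isT) (@Ordinal 6 5 isT)).
Qed.

End stable_kernels.

(** * Averages over tuples *)

Section tuple_counting.
Local Open Scope nat_scope.

(* Exchanging [x] with the entry [q] of [t] is an involution on pairs [(t, x)],
   so that, on average over [t], the entry [q] may be replaced by a free [x]. *)
Lemma card_tuple_rel_pair n m (B : rel 'I_n) K (p q : 'I_m) : p != q ->
  (forall j, #|[set l | B j l]%SET| * K <= n) ->
  #|[set t : m.-tuple 'I_n | B (tnth t p) (tnth t q)]%SET| * K <= n ^ m.
Proof.
move=> pq hB; case: (posnP n) => [n0|n0].
  rewrite (_ : [set _ | _]%SET = finset.set0) ?cards0//; apply/setP => t.
  by have := ltn_ord (tnth t p); rewrite [X in _ < X]n0.
pose swap (tx : m.-tuple 'I_n * 'I_n) : m.-tuple 'I_n * 'I_n :=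
  ([tuple if i == q then tx.2 else tnth tx.1 i | i < m], tnth tx.1 q).
have swapK : involutive swap.
  move=> [t x]; rewrite /swap/= tnth_mktuple eqxx; congr pair.
  by apply: eq_from_tnth => i; rewrite !tnth_mktuple; case: eqVneq => // ->.
rewrite -(leq_pmul2l n0) mulnA.
have -> : n * #|[set t : m.-tuple 'I_n | B (tnth t p) (tnth t q)]%SET| =
    \sum_(t : m.-tuple 'I_n) #|[set l | B (tnth t p) l]%SET|.
  rewrite -sum1dep_card big_distrr/= big_mkcond/=.
  transitivity (\sum_(t : m.-tuple 'I_n) \sum_(x < n) B (tnth t p) (tnth t q)).
    apply: eq_bigr => t _; rewrite sum_nat_const card_ord.
    by case: (B _ _); rewrite ?muln0.
  rewrite (pair_bigA _ (fun (t : m.-tuple 'I_n) (x : 'I_n) =>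
     nat_of_bool (B (tnth t p) (tnth t q))))/= (reindex_inj (inv_inj swapK))/=.
  rewrite -(pair_bigA _ (fun (t : m.-tuple 'I_n) (x : 'I_n) => nat_of_bool
     (B (tnth (swap (t, x)).1 p) (tnth (swap (t, x)).1 q))))/=.
  apply: eq_bigr => t _; rewrite -sum1dep_card [RHS]big_mkcond/=.
  apply: eq_bigr => x _; rewrite !tnth_mktuple eqxx (negbTE pq).
  by case: (B _ _).
rewrite big_distrl/=; apply: (@leq_trans (\sum_(t : m.-tuple 'I_n) n)).
  by apply: leq_sum => t _; exact: hB.
by rewrite sum_nat_const card_tuple card_ord mulnC.
Qed.

(** Each factor [n - k], [k < m], of the falling factorial is at least [n / 2]. This turns counts
    among all tuples into proportions among tuples of distinct indices. *)
Lemma expn_le_ffact n m : m.*2 <= n -> n ^ m <= 2 ^ m * n ^_ m.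
Proof.
elim: m => [//|m IHm] hm.
have hm' : m.*2 <= n by apply: leq_trans hm; rewrite doubleS; lia.
rewrite expnSr expnSr ffactnSr mulnACA leq_mul ?IHm//; lia.
Qed.

Lemma card_uniq_tuple_ord n m : #|[set t : m.-tuple 'I_n | uniq t]%SET| = n ^_ m.
Proof.
rewrite -[n in RHS]card_ord -(card_uniq_tuples m 'I_n).
by apply: eq_card => t; rewrite !inE (_ : all _ _)//; apply/allP => i; rewrite inE.
Qed.

End tuple_counting.

Section average.
Context {R : realType} {d m : nat}.
Implicit Types f : m.-tuple 'rV[R]_d -> R.

(** Separated tuples contribute at most [eta] each. The others are covered by at most [d * m * m]
    events, one for each coordinate and pair of positions, each of proportion at most
    [2 ^ m / K]. *)
Lemma avg_kernel_diff_le n f (a b : 'I_n -> 'rV[R]_d) (M eta delta : R) K :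
  (0 < K)%N -> (m.*2 <= n)%N -> 0 <= M -> 0 <= eta ->
  (forall t : m.-tuple 'I_n,
    `|f (map_tuple a t) - f (map_tuple b t)| <= M /\
    ((forall (p q : 'I_m) i, p != q ->
        delta < `|b (tnth t p) ord0 i - b (tnth t q) ord0 i|) ->
      `|f (map_tuple a t) - f (map_tuple b t)| <= eta)) ->
  (forall i j,
    (#|[set l | (`|b j ord0 i - b l ord0 i| <= delta)%R]%SET| * K <= n)%N) ->
  avg_kernel_diff f a b <= eta + M * (m * m * d * 2 ^ m)%:R / K%:R.
Proof.
move=> K0 mn M0 eta0 hf hB; rewrite /avg_kernel_diff.
have mlen : (m <= n)%N by apply: leq_trans mn; rewrite -addnn leq_addr.
have ff0 : (0 : R) < (n ^_ m)%:R by rewrite ltr0n ffact_gt0.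
have -> : (n - m)`!%:R / n`!%:R = (n ^_ m)%:R^-1 :> R.
  rewrite -(ffact_fact mlen) natrM invfM mulrCA mulfV ?mulr1//.
rewrite mulrC ler_pdivrMr//.
pose bad i (t : m.-tuple 'I_n) (p q : 'I_m) :=
  `|b (tnth t p) ord0 i - b (tnth t q) ord0 i| <= delta.
apply: (@le_trans _ _ (\sum_(t : m.-tuple 'I_n | uniq t)
    (eta + M * \sum_(i < d) \sum_(p < m) \sum_(q < m | p != q) (bad i t p q)%:R))).
  apply: ler_sum => t _; have [hM heta] := hf t.
  have sum_ge0 : (0 : R) <=
      \sum_(i < d) \sum_(p < m) \sum_(q < m | p != q) (bad i t p q)%:R.
    by do 3![apply: sumr_ge0 => ? _].
  (* One bad triple contributes 1 to the sum, which pays for [M]; without any, the tuple is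
     separated. *)
  have [/'exists_'exists_'exists_andP[i [p [q [pq hb]]]]|no_bad] :=
      boolP [exists i, exists p, exists q, (p != q) && bad i t p q].
    apply: le_trans hM _; apply: (@le_trans _ _ (eta + M * 1)).
      by rewrite mulr1 lerDr.
    rewrite lerD2l ler_wpM2l// (bigD1 i)//= (bigD1 p)//= (bigD1 q)//= hb.
    rewrite -!addrA lerDl !addr_ge0//; by do ?[apply: sumr_ge0 => ? _].
  apply: le_trans (heta _) _; last by rewrite lerDl mulr_ge0.
  move=> p q i pq; rewrite ltNge; apply: contra no_bad => hb.
  by apply/'exists_'exists_'exists_andP; exists i, p, q.
rewrite big_split/= -big_distrr/= mulrDl lerD//.
  by rewrite sumr_const -card_uniq_tuple_ord cardsE mulr_natr.
rewrite -!mulrA ler_wpM2l//.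
(* The condition [uniq t] is dropped after exchanging the sums, since the exchange argument counts
   all tuples. *)
apply: (@le_trans _ _ (\sum_(i < d) \sum_(p < m) \sum_(q < m | p != q)
    \sum_(t : m.-tuple 'I_n) (bad i t p q)%:R)).
  rewrite exchange_big/=; apply: ler_sum => i _.
  rewrite exchange_big/=; apply: ler_sum => p _.
  rewrite exchange_big/=; apply: ler_sum => q _.
  by rewrite [leRHS](bigID (fun t : m.-tuple 'I_n => uniq t))/= lerDl sumr_ge0.
apply: (@le_trans _ _ (\sum_(i < d) \sum_(p < m) \sum_(q < m)
    ((2 ^ m * n ^_ m)%:R / K%:R))).
  apply: ler_sum => i _; apply: ler_sum => p _.
  rewrite big_mkcond/=; apply: ler_sum => q _.
  case: ifPn => pq; last by rewrite divr_ge0.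
  rewrite ler_pdivlMr ?ltr0n// -natr_sum -natrM ler_nat.
  apply: leq_trans (expn_le_ffact mn).
  apply: leq_trans (card_tuple_rel_pair (B := fun j l =>
    `|b j ord0 i - b l ord0 i| <= delta) pq (hB i)).
  by rewrite -sum1dep_card [X in (_ <= X * _)%N]big_mkcond.
rewrite !sumr_const !card_ord -!mulrnA -mulr_natr !natrM le_eqVlt; apply/orP; left.
by apply/eqP; ring.
Qed.

(** The order of choices matters: [K] makes the bad tuples cost at most [e / 2], then [delta] is the
    least of the separations obtained for this [K], and [eps] comes last from the stability of [f]
    at [delta]. *)
Lemma avg_kernel_diff_cvg0 f (a b : forall n, 'I_n -> 'rV[R]_d) :
  stable_kernel f ->
  (forall eps : R, 0 < eps ->
    \forall n \near \oo, forall i, enorm (a n i - b n i) <= eps) ->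
  (forall i K, exists2 delta : R, 0 < delta & \forall n \near \oo, forall j,
    (#|[set l | (`|b n j ord0 i - b n l ord0 i| <= delta)%R]%SET| * K <= n)%N) ->
  avg_kernel_diff f (@a n) (@b n) @[n --> \oo] --> (0 : R).
Proof.
move=> [M M0 hf] hab hb; apply/cvgrPdist_le => e e0.
have [K K0 hK] : exists2 K, (0 < K)%N &
    M * (m * m * d * 2 ^ m)%:R / K%:R <= e / 2.
  set A := M * _; have A0 : 0 <= A by rewrite mulr_ge0.
  have hA : 2 * A / e < (Num.bound (2 * A / e)).+1%:R.
    rewrite (lt_le_trans (archi_boundP _)) ?ler_nat//.
    by rewrite divr_ge0 ?mulr_ge0// ltW.
  exists (Num.bound (2 * A / e)).+1 => //.
  by move: hA; rewrite ltr_pdivrMr// ler_pdivrMr ?ltr0n// => hA; lra.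
have /choice[delta_ hdelta_] : forall i, exists delta : R, 0 < delta /\
    \forall n \near \oo, forall j,
      (#|[set l | (`|b n j ord0 i - b n l ord0 i| <= delta)%R]%SET| * K <= n)%N.
  by move=> i; have [delta ? ?] := hb i K; exists delta.
pose delta := \big[Num.min/1]_(i < d) delta_ i.
have delta0 : 0 < delta.
  by apply: lt_bigmin => // i _; exact: (hdelta_ i).1.
have e20 : 0 < e / 2 by rewrite divr_gt0.
have [eps eps0 heps] := hf _ _ e20 delta0.
have hbad : \forall n \near \oo, forall i j,
    (#|[set l | (`|b n j ord0 i - b n l ord0 i| <= delta)%R]%SET| * K <= n)%N.
  apply: filter_forall => i; apply: filterS (hdelta_ i).2 => n h j.
  apply: leq_trans (h j); rewrite leq_mul2r subset_leq_card ?orbT//.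
  apply/fintype.subsetP => l; rewrite !inE => /le_trans; apply.
  exact: bigmin_le.
near=> n.
rewrite sub0r normrN ger0_norm; last first.
  by rewrite mulr_ge0 ?divr_ge0// sumr_ge0.
have : avg_kernel_diff f (@a n) (@b n) <=
    e / 2 + M * (m * m * d * 2 ^ m)%:R / K%:R.
  apply: (@avg_kernel_diff_le _ _ _ _ _ _ delta) => //.
  - by near: n; exact: nbhs_infty_ge.
  - exact: ltW.
  - move=> t; have nthE c (j : 'I_m) : (map_tuple c t)`_j = c (tnth t j) :> 'rV[R]_d.
      by rewrite -tnth_nth tnth_map.
    have [|hM heta] := heps (map_tuple (@a n) t) (map_tuple (@b n) t).
      move=> j; rewrite !nthE; move: (tnth t j).
      by near: n; exact: hab.
    by split => // sep; apply: heta => p q i pq; rewrite !nthE; exact: sep.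
  - by near: n.
move/le_trans; apply; rewrite [leRHS](splitr e) lerD2l.
exact: hK.
Unshelve. all: by end_near. Qed.

End average.

(** * Coordinates under the uniform law on the sphere *)

Section measurability.
Context {R : realType} {d : nat}.

Lemma measurable_coord (i : 'I_d) :
  measurable_fun setT (fun x : 'rV[R]_d => x ord0 i).
Proof.
move=> _ Y mY; rewrite setTI; apply: sub_sigma_algebra => /=.
rewrite -bigcup_seq/=; exists i => /=; first by rewrite mem_index_enum.
by exists Y => //; rewrite setTI.
Qed.

Lemma measurable_fun_rV d' (T : measurableType d') (f : T -> 'rV[R]_d) :
  (forall i, measurable_fun setT (fun x => f x ord0 i)) -> measurable_fun setT f.
Proof.
move=> mf _ A mA; rewrite setTI.
have := @g_sigma_preimage_comp _ R d 'rV[R]_d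
  (fun i (x : 'rV[R]_d) => x ord0 i) _ f.
move=> /(congr1 (fun G : set (set T) => G (f @^-1` A))) h.
have : preimage_set_system setT f
    (g_sigma_preimage (fun i (x : 'rV[R]_d) => x ord0 i)) (f @^-1` A).
  by exists A => //; rewrite setTI.
rewrite -h; apply: smallest_sub; first exact: sigma_algebra_measurable.
rewrite -bigcup_seq/=; apply: bigcup_sub => i _ B [C mC <-].
exact: mf.
Qed.

Lemma measurable_coord0_neq0 (i j : 'I_d) :
  measurable [set x : 'rV[R]_d | x ord0 i = 0 /\ x ord0 j != 0].
Proof.
rewrite (_ : [set x | _] = (fun x : 'rV[R]_d => x ord0 i) @^-1` [set 0] `&`
    (fun x : 'rV[R]_d => x ord0 j) @^-1` (~` [set 0])); last first.
  by apply/seteqP; split => x /= [-> /eqP].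
by apply: measurableI; rewrite -[X in measurable X]setTI;
  apply: measurable_coord => //; exact: measurableC.
Qed.

Lemma measurable_enorm : measurable_fun setT (@enorm R d).
Proof.
apply: (@measurableT_comp _ _ _ _ _ _ (@Num.sqrt R)).
  by apply: continuous_measurable_fun; exact: sqrt_continuous.
by apply: measurable_sum => i; apply: measurable_funM; exact: measurable_coord.
Qed.

Lemma measurable_sphere : measurable (@sphere R d).
Proof.
rewrite (_ : sphere = enorm @^-1` [set 1])//.
by rewrite -[X in measurable X]setTI; apply: measurable_enorm.
Qed.

Lemma measurable_score_vec_coord (J : R -> R) (i : 'I_d) : measurable_fun setT J ->
  measurable_fun setT (fun x : 'rV[R]_d => score_vec J x ord0 i).
Proof.
move=> mJ; rewrite (_ : (fun x : 'rV[R]_d => _) =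
    fun x : 'rV[R]_d => J (enorm x) * (enorm x `^ (-1)) * x ord0 i); last first.
  by apply/funext => x; rewrite score_vecE mxE powR_inv1// enorm_ge0.
apply: measurable_funM; last exact: measurable_coord.
apply: measurable_funM; first exact: measurableT_comp mJ measurable_enorm.
exact: measurableT_comp (measurable_powR _) measurable_enorm.
Qed.

End measurability.

Section uniform_sphere_coordinates.
Context {R : realType} {d : nat}.

(** Reflection in the hyperplane orthogonal to [v], acting on row vectors from the right. *)
Let householder (v : 'rV[R]_d) : 'M[R]_d :=
  1%:M - (2 / dot v v) *: (v^T *m v).

Let mul_householder v x :
  x *m householder v = x - (2 * dot x v / dot v v) *: v.
Proof.
rewrite mulmxBr mulmx1 -scalemxAr mulmxA; congr (_ - _).
rewrite (_ : x *m v^T = (dot x v)%:M); last first.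
  apply/matrixP => i j; rewrite !ord1 !mxE eqxx mulr1n.
  by apply: eq_bigr => k _; rewrite mxE.
by rewrite mul_scalar_mx scalerA mulrAC.
Qed.

Let householder_orthogonal v : v != 0 ->
  householder v *m (householder v)^T = 1%:M.
Proof.
move=> v0; have vv0 : dot v v != 0 by rewrite dot_eq0.
have -> : (householder v)^T = householder v.
  by rewrite /householder linearB linearZ/= trmx1 trmx_mul trmxK.
apply/row_matrixP => i; rewrite row_mul !mul_householder.
set x := row i _.
have -> : x = row i 1%:M - (2 * dot (row i 1%:M) v / dot v v) *: v.
  by rewrite -mul_householder -row_mul mul1mx.
set y := row i _; rewrite dotDl dotNl dotZl -addrA -opprD -scalerDl.
rewrite [X in X *: _](_ : _ = 0) ?scale0r ?subr0//.
by field.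
Qed.

(* The reflections along [e_i + k e_j], [k > 0], map this set to pairwise
   disjoint sets of the same measure. *)
Lemma uniform_sphere_coord0_neq0 (sigma : probability 'rV[R]_d R) (i j : 'I_d) :
  i != j -> uniform_sphere sigma ->
  sigma [set x : 'rV[R]_d | x ord0 i = 0 /\ x ord0 j != 0] = 0%E.
Proof.
move=> ij [_ inv]; set A := [set x : 'rV[R]_d | _].
have mA : measurable A := measurable_coord0_neq0 i j.
pose v (k : nat) : 'rV[R]_d := delta_mx 0 i + k.+1%:R *: delta_mx 0 j.
have dotv k x : dot x (v k) = x ord0 i + k.+1%:R * x ord0 j.
  rewrite /dot (bigD1 i)//= (bigD1 j) 1?eq_sym//= big1 ?addr0; last first.
    move=> l /andP[li lj]; rewrite !mxE (negbTE li) (negbTE lj) andbF.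
    by rewrite mulr0 addr0 mulr0.
  rewrite !mxE !eqxx/= (negbTE ij) eq_sym (negbTE ij) /=; ring.
have vi k : v k ord0 i = 1 by rewrite !mxE !eqxx (negbTE ij)/= mulr0 addr0.
have vj k : v k ord0 j = k.+1%:R.
  by rewrite !mxE !eqxx eq_sym (negbTE ij)/= mulr1 add0r.
have v0 k : v k != 0.
  by apply/eqP => /rowP/(_ i); rewrite vi mxE => /eqP; rewrite oner_eq0.
have subZE (x y : 'rV[R]_d) a l :
    (x - a *: y) ord0 l = x ord0 l - a * y ord0 l by rewrite !mxE.
pose F k := (fun x => x *m householder (v k)) @^-1` A.
have sF k : sigma (F k) = sigma A by apply: inv => //; exact: householder_orthogonal.
have mF k : measurable (F k).
  rewrite /F -[X in measurable X]setTI.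
  apply: measurable_fun_rV => // l.
  under eq_fun do rewrite mul_householder subZE dotv.
  apply: measurable_funB; first exact: measurable_coord.
  by do 4?[apply: measurable_funM => //]; apply: measurable_funD => //;
    [exact: measurable_coord|apply: measurable_funM => //; exact: measurable_coord].
(* The reflected point lies in [A]: its vanishing coordinate [i] is a linear relation between the
   coordinates [i] and [j] of [x], and these are not both 0, as otherwise the reflected coordinate
   [j] would vanish too. *)
have FE k x : F k x ->
    (k.+1%:R ^+ 2 - 1) * x ord0 i = 2 * k.+1%:R * x ord0 j /\
    (x ord0 i != 0 \/ x ord0 j != 0).
  have vv : dot (v k) (v k) = 1 + k.+1%:R ^+ 2 by rewrite dotv vi vj.
  have vv0 : 1 + k.+1%:R ^+ 2 != 0 :> R by rewrite gt_eqF// ltr_wpDr// sqr_ge0.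
  rewrite /F/A /= mul_householder !subZE vi vj dotv vv => -[h1 h2]; split.
    move: h1 => /(congr1 ( *%R (1 + k.+1%:R ^+ 2))); rewrite mulr0 => h1.
    have : (k.+1%:R ^+ 2 - 1) * x ord0 i - 2 * k.+1%:R * x ord0 j = 0.
      by rewrite -h1; field.
    by move/eqP; rewrite subr_eq0 => /eqP.
  have [xi|] := eqVneq (x ord0 i) 0; last by left.
  right; apply: contra h2 => /eqP xj.
  by rewrite xi xj mulr0 addr0 mulr0 !mul0r subr0.
have tF : trivIset setT F.
  move=> k l _ _ [x [/FE[hk xn0] /FE[hl _]]].
  apply/eqP; apply: contraT => kl.
  have kl' : k.+1%:R - l.+1%:R != 0 :> R by rewrite subr_eq0 eqr_nat.
  have k0 : (0 : R) < k.+1%:R by rewrite ltr0n.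
  have l0 : (0 : R) < l.+1%:R by rewrite ltr0n.
  (* Eliminating [x ord0 j] from the relations for [k] and [l] leaves a nonzero multiple of
     [x ord0 i]; either relation then gives [x ord0 j = 0]. *)
  have xi : x ord0 i = 0.
    have /eqP : (k.+1%:R - l.+1%:R) * (k.+1%:R * l.+1%:R + 1) * x ord0 i = 0.
      transitivity (l.+1%:R * ((k.+1%:R ^+ 2 - 1) * x ord0 i) -
        k.+1%:R * ((l.+1%:R ^+ 2 - 1) * x ord0 i)); first by ring.
      by rewrite hk hl; ring.
    rewrite !mulf_eq0 (negbTE kl') orFb => /orP[|/eqP//].
    by rewrite gt_eqF// addr_gt0// mulr_gt0.
  case: xn0; first by rewrite xi eqxx.
  move: hk; rewrite xi mulr0 => /esym/eqP.
  by rewrite !mulf_eq0 pnatr_eq0/= gt_eqF//= => /eqP ->; rewrite eqxx.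
(* Any number of disjoint copies of [A] fit into total mass 1, so the mass of [A] is 0 by the
   Archimedean property. *)
have bound n : fine (sigma A) *+ n <= 1.
  rewrite -lee_fin -(@probability_setT _ _ _ sigma).
  apply: (@le_trans _ _ (sigma (\big[setU/set0]_(k < n) F k))).
    rewrite measure_bigsetU// (eq_bigr (fun=> (fine (sigma A))%:E)).
      by rewrite sumEFin sumr_const card_ord.
    by move=> k _; rewrite fineK ?fin_num_measure//; exact: sF.
  by apply: le_measure; rewrite ?inE//; exact: bigsetU_measurable.
rewrite -[LHS]fineK ?fin_num_measure//; congr EFin.
apply/eqP; rewrite eq_le fine_ge0 ?measure_ge0// andbT leNgt.
apply/negP => A0; have := archi_boundP (ltW (divr_gt0 ltr01 A0)).
by rewrite ltr_pdivrMr// mulr_natl ltNge bound.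
Qed.

(** Where coordinate [i] vanishes, so do almost surely all the others, by the previous lemma; but 0
    is not on the sphere. *)
Lemma uniform_sphere_coord0 (sigma : probability 'rV[R]_d R) (i : 'I_d) :
  uniform_sphere sigma -> {ae sigma, forall x, @sphere R d x /\ x ord0 i != 0}.
Proof.
move=> us; have [s1 _] := us.
have sph : {ae sigma, forall x, @sphere R d x}.
  exists (~` @sphere R d); split => //; first by apply: measurableC; exact: measurable_sphere.
  by rewrite probability_setC ?s1 ?subee//; exact: measurable_sphere.
have : {ae sigma, forall x : 'rV[R]_d, forall j, ~ (x ord0 i = 0 /\ x ord0 j != 0)}.
  apply: filter_forall => j; have [<-|ij] := eqVneq i j.
    by apply: aeW => x [->]; rewrite eqxx.
  exists [set x : 'rV[R]_d | x ord0 i = 0 /\ x ord0 j != 0]; split.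
  - exact: measurable_coord0_neq0.
  - exact: uniform_sphere_coord0_neq0.
  - by move=> x /= /contrapT.
apply: filterS2 sph => x xs xi; split => //; apply/eqP => x0.
have /eqP : x = 0.
  apply/rowP => j; rewrite mxE; have [//|xj] := eqVneq (x ord0 j) 0.
  by case: (xi j).
by rewrite -enorm_eq0 xs oner_eq0.
Qed.

End uniform_sphere_coordinates.

(** * The law of the scores *)

Section score_law.
Context {R : realType} {d : nat}.
Implicit Types (mu : probability 'rV[R]_d R) (F : 'rV[R]_d -> 'rV[R]_d).

(** Outside [[0, 1[] nothing is known about [J]; extending it by 0 makes it measurable on the whole
    line without changing scores in the open ball. *)
Let restricted (J : R -> R) : R -> R := J \_ `[0, 1[.

Let score_vec_restricted J (u : 'rV[R]_d) : enorm u < 1 ->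
  score_vec J u = score_vec (restricted J) u.
Proof.
move=> u1; rewrite !score_vecE /restricted patchE mem_set//=.
by rewrite in_itv/= enorm_ge0.
Qed.

Let measurable_restricted J : strongly_regular J ->
  measurable_fun setT (restricted J).
Proof.
case=> _ cJ _ _ _.
have mI : measurable (`[0, 1[%classic : set R) by exact: measurable_itv.
apply/(measurable_restrictT J mI).
by apply: subspace_continuous_measurable_fun.
Qed.

Let score_cofE mu F J : center_outward mu F ->
  (fun x => score_vec J (F x)) = (fun x => score_vec (restricted J) (F x)).
Proof. by case=> _ F1 _ _; apply/funext => x; rewrite score_vec_restricted. Qed.

Lemma measurable_score_cof mu F J i :
  center_outward mu F -> strongly_regular J ->
  measurable_fun setT (fun x => score_vec J (F x) ord0 i).
Proof.
move=> cF /measurable_restricted mJ.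
have -> : (fun x => score_vec J (F x) ord0 i) =
    (fun x => score_vec (restricted J) (F x) ord0 i).
  by apply/funext => x; have /funeqP/(_ x) -> := score_cofE J cF.
case: cF => mF _ _ _.
exact: measurableT_comp (measurable_score_vec_coord i mJ) mF.
Qed.

Lemma uniform_prob01_countable (A : set R) :
  measurable A -> countable (A `&` `[0, 1]) -> uniform_prob (@ltr01 R) A = 0%E.
Proof.
move=> mA cA; rewrite /uniform_prob integral_uniform_pdf null_set_integral//.
- exact: measurableI.
- apply: measurable_funTS; apply/measurable_EFinP.
  exact: measurable_uniform_pdf.
- exact: countable_lebesgue_measure0.
Qed.

(** Fubini: by uniqueness the product measure may be computed by integrating over the radius first,
    and almost every direction has a countable, hence null, set of radii. *)
Lemma U_law_null (sigma : probability 'rV[R]_d R) (B : set 'rV[R]_d) :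
  measurable B ->
  {ae sigma, forall s, countable ((fun r => r *: s) @^-1` B `&` `[0, 1])} ->
  U_law sigma B = 0%E.
Proof.
move=> mB cB; rewrite /U_law /pushforward; set C := _ @^-1` B.
have mscale : measurable_fun setT (fun rs : R * 'rV[R]_d => rs.1 *: rs.2).
  apply: measurable_fun_rV => i; under eq_fun do rewrite mxE.
  apply: measurable_funM; first exact: measurable_fst.
  exact: measurableT_comp (measurable_coord i) measurable_snd.
have mC : measurable C by rewrite -[C]setTI; exact: mscale.
have -> : (uniform_prob (@ltr01 R) \x sigma)%E C =
    (uniform_prob (@ltr01 R) \x^ sigma)%E C.
  by apply: product_measure_unique => //= *; rewrite product_measure2E.
rewrite /product_measure2 (ae_eq_integral (cst 0%E))//; first exact: integral0.
- exact: measurable_fun_ysection.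
- apply: filterS cB => s cs _ /=; apply: uniform_prob01_countable.
    exact: measurable_ysection.
  by rewrite (_ : ysection C s = (fun r => r *: s) @^-1` B)// ysectionE.
Qed.

(* On the sphere, [r s] has score [J r * s_i]; for [s_i != 0] strict
   monotonicity of [J] leaves at most one [r] in ]0, 1[ for each level [t]. *)
Lemma score_cof_atomless mu F J i (t : R) :
  center_outward mu F -> strongly_regular J ->
  mu [set x | score_vec J (F x) ord0 i = t] = 0%E.
Proof.
move=> cF rJ; have mJ := measurable_restricted rJ.
pose B : set 'rV[R]_d := [set u | score_vec (restricted J) u ord0 i = t].
have mB : measurable B.
  have := measurable_score_vec_coord i mJ measurableT (measurable_set1 t).
  by rewrite setTI.
have -> : [set x | score_vec J (F x) ord0 i = t] = F @^-1` B.
  by apply/seteqP; split => x; rewrite /B/=; have /funeqP/(_ x) -> := score_cofE J cF.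
case: cF => _ _ _ [sigma [us /(_ B mB)]]; rewrite /pushforward => ->.
apply: U_law_null => //; apply: filterS (uniform_sphere_coord0 i us) => s [s1 si].
(* The only candidate in ]0, 1[. The end points are set aside: at 0 the norm cannot be cancelled,
   and at 1 [restricted J] is cut off. *)
pose r0 := xget 0 [set r | 0 <= r < 1 /\ J r * s ord0 i = t].
apply: (@sub_countable _ _ _ [set 0; 1; r0]).
  apply: subset_card_le => r [Br /=]; rewrite in_itv/= => /andP[].
  rewrite le_eqVlt => /orP[/eqP <-|r_gt0]; first by left; left.
  rewrite le_eqVlt => /orP[/eqP ->|r_lt1]; first by left; right.
  right; have r01 : 0 <= r < 1 by rewrite ltW.
  have nr : enorm (r *: s) = r by rewrite enormZ s1 mulr1 gtr0_norm.
  have Jr : J r * s ord0 i = t.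
    move: Br; rewrite /B/= -score_vec_restricted ?nr// score_vecE nr !mxE mulrA.
    by rewrite divfK ?gt_eqF.
  rewrite /r0; case: xgetP => [y _ [y01 Jy]|/(_ r) []//].
  by apply: (strongly_regular_inj rJ) => //; apply: (mulIf si); rewrite Jr Jy.
by apply: finite_set_countable; rewrite !finite_setU.
Qed.

End score_law.

(** * Absence of clusters in the sample *)

Section large_cells.
Context {R : realType} {disp : measure_display} {T : measurableType disp}.
Variable P : probability T R.
Context {dE : measure_display} {E : measurableType dE}.

Lemma measure_bigsetU_le (I : Type) (s : seq I) (Q : pred I) (A : I -> set T) :
  (forall i, measurable (A i)) ->
  (P (\big[setU/set0]_(i <- s | Q i) A i) <= \sum_(i <- s | Q i) P (A i))%E.
Proof.
move=> mA; elim: s => [|i s IHs]; first by rewrite !big_nil measure0.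
rewrite !big_cons; case: ifP => // _.
by apply: le_trans (measureU2 _ _ _) _ => //; [exact: bigsetU_measurable|rewrite leeD2l].
Qed.

Lemma iid_prob_setI (Z : nat -> T -> E) (law : set E -> \bar R) (B : set E) n
    (I : {set 'I_n}) : iid P Z law -> measurable B ->
  P (\big[setI/setT]_(l in I) Z l @^-1` B) = ((fine (law B)) ^+ #|I|)%:E.
Proof.
move=> [mZ lawZ indep] mB.
have Bfin : law B = (fine (law B))%:E.
  rewrite fineK// -(lawZ 0%N)// fin_num_measure// -[X in measurable X]setTI.
  exact: mZ.
pose s := [seq val l | l <- enum I].
have -> : \big[setI/setT]_(l in I) Z l @^-1` B =
    \bigcap_(l in [set` s]) (Z l @^-1` B).
  rewrite -big_enum -bigcap_seq; apply/seteqP; split => w h l /=.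
    by move=> /mapP[k kI ->]; exact: h.
  by move=> lI; apply: h => /=; exact: map_f.
rewrite (indep s (fun=> B))//; last by rewrite map_inj_uniq ?enum_uniq//; exact: val_inj.
rewrite (eq_bigr (fun=> (fine (law B))%:E)); last by move=> l _; rewrite lawZ.
rewrite big_map big_enum/=.
by rewrite prodEFin prodr_const.
Qed.

(* A union bound over the at most [2 ^ n] index sets [I] with [#|I| * K > n],
   each of which contributes at most [4 ^ (- n)]; no law of large numbers is
   needed, as the cell may be taken as small as wanted. *)
Lemma iid_count_small_cell (Z : nat -> T -> E) (law : set E -> \bar R)
    (B : set E) K : iid P Z law -> measurable B ->
  (law B <= ((4 ^+ K)^-1 : R)%:E)%E ->
  {ae P, forall w, \forall n \near \oo,
    (#|[set l : 'I_n | Z l w \in B]%SET| * K <= n)%N}.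
Proof.
move=> iidZ mB smallB; have [mZ lawZ _] := iidZ.
pose D n : set T := \big[setU/set0]_(I : {set 'I_n} | (n < #|I| * K)%N)
  \big[setI/setT]_(l in I) Z l @^-1` B.
have mI n (I : {set 'I_n}) : measurable (\big[setI/setT]_(l in I) Z l @^-1` B).
  apply: bigsetI_measurable => l _; rewrite -[X in measurable X]setTI.
  exact: mZ.
have mD n : measurable (D n) by apply: bigsetU_measurable => I _; exact: mI.
have law_ge0 : 0 <= fine (law B) by rewrite fine_ge0// -(lawZ 0%N).
have law_le : fine (law B) <= (4 ^+ K)^-1.
  rewrite -lee_fin fineK// -(lawZ 0%N)// fin_num_measure//.
  by rewrite -[X in measurable X]setTI; exact: mZ.
(* The total [2 ^ n * 4 ^ (- n) = 2 ^ (- n)] is written in the form summed by [epsilon_trick0]. *)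
have PD n : (P (D n) <= (2 / (2 ^ n.+1)%:R)%:E)%E.
  apply: le_trans (measure_bigsetU_le _ _ _) _ => //.
  apply: (@le_trans _ _ (\sum_(I : {set 'I_n}) ((4 ^+ n)^-1 : R)%:E)%E).
    rewrite big_mkcond/=; apply: lee_sum => I _.
    case: ifPn => [nI|_]; last by rewrite lee_fin invr_ge0 exprn_ge0.
    rewrite (iid_prob_setI I iidZ mB) lee_fin.
    apply: (@le_trans _ _ (((4 ^+ K)^-1) ^+ #|I|)).
      by rewrite lerXn2r ?nnegrE ?invr_ge0 ?exprn_ge0.
    rewrite exprVn -exprM lef_pV2 ?posrE ?exprn_gt0//.
    by rewrite ler_weXn2l ?ler1n// mulnC ltnW.
  rewrite sumEFin lee_fin sumr_const -cardsT -powersetT card_powerset cardsT card_ord.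
  have -> : (4 : R) ^+ n = 2 ^+ n * 2 ^+ n by rewrite -exprMn -natrM.
  rewrite -[_ *+ (2 ^ n)]mulr_natr !natrX exprS.
  have : (2 ^+ n : R) != 0 by rewrite expf_neq0.
  move: (2 ^+ n) => x x0; rewrite le_eqVlt; apply/orP; left; apply/eqP.
  by field.
(* Borel-Cantelli. *)
have limD : P (lim_sup_set D) = 0%E.
  apply: lim_sup_set_cvg0 => //.
  apply: (@le_lt_trans _ _ (\sum_(n <oo) (2 / (2 ^ n.+1)%:R)%:E)%E).
    by apply: lee_nneseries => // n _; exact: PD.
  by apply: le_lt_trans (epsilon_trick0 _ _) _ => //; rewrite ltry.
exists (lim_sup_set D); split => //.
  apply: bigcap_measurable => // n _; exact: bigcup_measurable.
move=> w /= notw; apply: contrapT => Dw; apply: notw.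
have /existsNP[N hN] : ~ forall N, (\bigcup_(n >= N) D n) w by move=> h; apply: Dw => N _; exact: h.
exists N => // n /= Nn; rewrite leqNgt; apply/negP => bad; apply: hN.
(* The set of all indices that hit [B] is itself one of the sets in the union [D n]. *)
exists n => //; rewrite /D; set I := [set l | _]%SET in bad.
rewrite (bigD1 I)//=; left.
rewrite -big_enum -bigcap_seq => l /=; rewrite mem_enum /I inE => h.
exact: set_mem.
Qed.

Lemma measurable_dist_lt (h : E -> R) (t r : R) : measurable_fun setT h ->
  measurable [set x | `|h x - t| < r].
Proof.
move=> mh; have : measurable_fun setT (fun x => `|h x - t|).
  by apply: measurableT_comp => //; exact: measurable_funB.
move=> /(_ measurableT `]-oo, r[%classic (measurable_itv _)).
by rewrite setTI; congr measurable; apply/seteqP; split => x; rewrite /= in_itv.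
Qed.

(** Continuity from above along intervals shrinking to [t]. The factor 2 leaves room for the
    neighbours of points in the ball of radius [r]. *)
Lemma atomless_small_ball (mu : probability E R) (h : E -> R) (t eta : R) :
  measurable_fun setT h -> mu [set x | h x = t] = 0%E -> 0 < eta ->
  exists2 r : R, 0 < r & (mu [set x | `|h x - t| < 2 * r]%R <= eta%:E)%E.
Proof.
move=> mh mut eta0.
pose F k := [set x | `|h x - t| < k.+1%:R^-1].
have mF k : measurable (F k) by exact: measurable_dist_lt.
have capF : \bigcap_k F k = [set x | h x = t].
  apply/seteqP; split => x /= => [Fx|hxt k _]; last first.
    by rewrite /F/= hxt subrr normr0 invr_gt0.
  apply/eqP; rewrite -subr_eq0 -normr_le0 leNgt; apply/negP => ht.
  have := Fx (Num.bound `|h x - t|^-1) I; rewrite /F/= ltNge => /negP; apply.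
  rewrite invf_ple ?posrE ?ltr0n// (le_trans (ltW (archi_boundP _)))//.
  by rewrite ler_nat.
have : mu \o F @ \oo --> mu (\bigcap_k F k).
  apply: nonincreasing_cvg_mu => //.
  - by rewrite (le_lt_trans (probability_le1 _ _))// ltry.
  - exact: bigcap_measurable.
  - move=> k l kl; apply/subsetPset => x; rewrite /F/= => /lt_le_trans; apply.
    by rewrite lef_pV2 ?posrE ?ltr0n// ler_nat.
rewrite capF mut => /fine_cvgP[_] /cvgrPdist_lt /(_ _ eta0)[k _ /(_ k (leqnn _))].
rewrite sub0r normrN /= ger0_norm ?fine_ge0// => Fk.
exists (k.+1%:R^-1 / 2); first by rewrite divr_gt0 ?invr_gt0.
rewrite mulrC divfK//.
by rewrite -(fineK (fin_num_measure mu _ (mF k))) lee_fin ltW.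
Qed.

(** Let [delta] be at most every radius of a finite cover of [[- M, M]]. The [delta]-neighbours of a
    point in one ball lie in the doubled ball, so finitely many cells control the counts for all [j]
    at once, and [delta] does not depend on [w]. *)
Lemma iid_no_clusters (Z : nat -> T -> E) (mu : probability E R) (h : E -> R)
    (M : R) K : iid P Z mu -> measurable_fun setT h ->
  (forall x, `|h x| <= M) -> (forall t, mu [set x | h x = t] = 0%E) ->
  exists2 delta : R, 0 < delta & {ae P, forall w, \forall n \near \oo,
    forall j : 'I_n,
      (#|[set l : 'I_n | (`|h (Z j w) - h (Z l w)| <= delta)%R]%SET| * K <= n)%N}.
Proof.
move=> iidZ mh hM atomless.
have eta0 : 0 < (4 ^+ K)^-1 :> R by rewrite invr_gt0 exprn_gt0.
have /choice[r hr] : forall t, exists r : R, 0 < r /\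
    (mu [set x | `|h x - t| < 2 * r]%R <= ((4 ^+ K)^-1 : R)%:E)%E.
  by move=> t; have [r] := atomless_small_ball mh (atomless t) eta0; exists r.
have := @segment_compact R (- M) M; rewrite compact_cover.
move=> /(_ R setT (fun t => ball t (r t))) [].
- by move=> t _; exact: ball_open.
- by move=> t _; exists t => //; apply: ballxx; exact: (hr t).1.
move=> D _ coverD; pose delta := \big[Num.min/1]_(t : D) r (val t).
exists delta; first by apply: lt_bigmin => // t _; exact: (hr _).1.
pose B t := [set x | `|h x - t| < 2 * r t].
have mB t : measurable (B t) by exact: measurable_dist_lt.
have : {ae P, forall w, forall t : D, \forall n \near \oo,
    (#|[set l : 'I_n | Z l w \in B (val t)]%SET| * K <= n)%N}.
  apply: filter_forall => t.
  by apply: iid_count_small_cell iidZ (mB _) _; exact: (hr _).2.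
apply: filterS => w /filter_forall; apply: filterS => n hn j.
have : `[- M, M]%classic (h (Z j w)).
  by rewrite /= in_itv/= -ler_norml.
move=> /coverD[t tD]; rewrite /ball/= distrC => hj.
apply: leq_trans (hn [` tD]%fset).
rewrite leq_mul2r subset_leq_card ?orbT//.
apply/fintype.subsetP => l; rewrite !inE => hjl;
have dr : delta <= r t := bigmin_le _ [` tD]%fset _.
rewrite /B/=.
have -> : h (Z l w) - t = (h (Z l w) - h (Z j w)) + (h (Z j w) - t) by ring.
by rewrite (le_lt_trans (ler_normD _ _))// distrC; lra.
Qed.

End large_cells.

(** * Convergence *)

(** On one almost sure event, the Lipschitz bound [3 * L] carries the uniform convergence of the
    sample maps over to the scores, and the population scores do not cluster; the deterministic
    convergence lemma then applies for each [w]. *)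
Lemma avg_kernel_diff_sample_cof_cvg0 (R : realType) (d m : nat)
    (f : m.-tuple 'rV[R]_d -> R) (disp : measure_display)
    (T : measurableType disp) (P : probability T R) (Z : nat -> T -> 'rV[R]_d)
    (mu : probability 'rV[R]_d R) (g : grid_design R d)
    (S : forall n, T -> {set 'I_(n_S g n)}) (F : 'rV[R]_d -> 'rV[R]_d)
    (J : R -> R) :
  iid P Z mu -> admissible_design g -> grid_sample P S Z -> P_sharp g mu ->
  center_outward mu F -> strongly_regular J -> stable_kernel f ->
  {ae P, forall w, (fun n : nat => avg_kernel_diff f
    (fun i : 'I_n => score_vec J (sample_cof S Z n w (Z i w)))
    (fun i : 'I_n => score_vec J (F (Z i w)))) @ \oo --> (0 : R)}.
Proof.
move=> iidZ ag gS [_ sharp] cF rJ stab.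
have [L L0 hL] := strongly_regular_lip rJ.
have J0 : J 0 = 0 by case: rJ => _ _ _ _ [].
have F1 x : enorm (F x) < 1 by case: cF.
(* Lipschitz comparison with the zero vector, whose score is 0. *)
have bound i x : `|score_vec J (F x) ord0 i| <= 3 * L.
  apply: le_trans (coord_le_enorm _ _) _.
  have := @score_vec_lip _ d J L (F x) 0 (ltW L0) J0 hL (F1 x).
  rewrite enorm0 ltr01 /score_vec eqxx !subr0 => /(_ isT) /le_trans; apply.
  by rewrite -[leRHS]mulr1 ler_wpM2l ?mulr_ge0 ?(ltW L0) ?(ltW (F1 x)).
have clusters i K : exists delta : R, 0 < delta /\
    {ae P, forall w, \forall n \near \oo, forall j : 'I_n,
      (#|[set l : 'I_n | (`|score_vec J (F (Z j w)) ord0 i -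
          score_vec J (F (Z l w)) ord0 i| <= delta)%R]%SET| * K <= n)%N}.
  have [delta delta0 h] := iid_no_clusters (h := fun x => score_vec J (F x) ord0 i)
    K iidZ (measurable_score_cof i cF rJ) (bound i)
    (fun t => score_cof_atomless i t cF rJ).
  by exists delta.
have {}clusters : {ae P, forall w, forall K i, exists2 delta : R, 0 < delta &
    \forall n \near \oo, forall j : 'I_n,
      (#|[set l : 'I_n | (`|score_vec J (F (Z j w)) ord0 i -
          score_vec J (F (Z l w)) ord0 i| <= delta)%R]%SET| * K <= n)%N}.
  (* Countably many [K] and finitely many coordinates: a single null set serves for all of them. *)
  apply: ae_foralln => K; apply: filter_forall => i.
  by have [delta [delta0]] := clusters i K; apply: filterS => w h; exists delta.
apply: filterS2 (sharp F cF _ _ _ _ _ iidZ gS) clusters => w unif clusters.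
apply: avg_kernel_diff_cvg0 => // eps eps0.
have e0 : 0 < eps / (3 * L) by rewrite divr_gt0// mulr_gt0.
move/cvgrPdist_lt : unif => /(_ _ e0); apply: filterS => n.
rewrite sub0r normrN => /(le_lt_trans (ler_norm _)) hmax i.
apply: (le_trans (@score_vec_lip _ d J L _ _ (ltW L0) J0 hL _ (F1 _))).
  exact: sample_cof_enorm_lt1.
rewrite mulrC -ler_pdivlMr ?mulr_gt0//; apply: le_trans (ltW hmax).
exact: (le_bigmax _ (fun i : 'I_n => enorm (sample_cof S Z n w (Z i w) - F (Z i w)))).
Qed.

Section marginals.
Context {R : realType} {disp : measure_display} {T : measurableType disp}.
Variable P : probability T R.
Context {d1 d2 : measure_display} {E1 : measurableType d1} {E2 : measurableType d2}.

Lemma iid_comp (Y : nat -> T -> E1) (X : T -> E1) (h : E1 -> E2) :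
  measurable_fun setT h -> iid P Y (pushforward P X) ->
  iid P (fun i w => h (Y i w)) (pushforward P (fun w => h (X w))).
Proof.
move=> mh [mY lawY indep]; have mhB B : measurable B -> measurable (h @^-1` B).
  by move=> mB; rewrite -[X in measurable X]setTI; exact: mh.
split.
- by move=> i; exact: measurableT_comp mh (mY i).
- by move=> i A mA; have := lawY i _ (mhB _ mA).
- by move=> I B uI mB; have := indep I _ uI (fun i => mhB _ (mB i)).
Qed.

(** The events generated by the images [h (Y i w)] are among those generated by [Y], so independence
    passes to a margin. *)
Lemma grid_sample_comp d (g : grid_design R d) (S : forall n, T -> {set 'I_(n_S g n)})
    (Y : nat -> T -> E1) (h : E1 -> E2) :
  measurable_fun setT h -> grid_sample P S Y ->
  grid_sample P S (fun i w => h (Y i w)).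
Proof.
move=> mh gY d_gt1; have [mS lawS indep] := gY d_gt1; split => // A B sA sB.
apply: indep => //; apply: sub_sigma_algebra2 sB => _ [i [C [mC ->]]].
exists i, (h @^-1` C); split => //.
by rewrite -[X in measurable X]setTI; exact: mh.
Qed.

End marginals.

Theorem theorem4p1 (R : realType) (d1 d2 : nat)
  (hd1 : (0 < d1)%N) (hd2 : (0 < d2)%N)
  (disp : measure_display) (T : measurableType disp) (P : probability T R)
  (X1 : {RV P >-> 'rV[R]_d1}) (X2 : {RV P >-> 'rV[R]_d2})
  (X1s : nat -> T -> 'rV[R]_d1) (X2s : nat -> T -> 'rV[R]_d2)
  (hX : iid P (fun i w => (X1s i w, X2s i w))
          (pushforward P (fun w => (X1 w, X2 w))))
  (g1 : grid_design R d1) (g2 : grid_design R d2)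
  (hg1 : admissible_design g1) (hg2 : admissible_design g2)
  (S1 : forall n, T -> {set 'I_(n_S g1 n)})
  (S2 : forall n, T -> {set 'I_(n_S g2 n)})
  (hS1 : grid_sample P S1 (fun i w => (X1s i w, X2s i w)))
  (hS2 : grid_sample P S2 (fun i w => (X1s i w, X2s i w)))
  (hP1 : P_sharp g1 (distribution P X1))
  (hP2 : P_sharp g2 (distribution P X2))
  (F1 : 'rV[R]_d1 -> 'rV[R]_d1) (F2 : 'rV[R]_d2 -> 'rV[R]_d2)
  (hF1 : center_outward (distribution P X1) F1)
  (hF2 : center_outward (distribution P X2) F2)
  (J1 J2 : R -> R) (hJ1 : strongly_regular J1) (hJ2 : strongly_regular J2)
  (c : kernel_pair) :
  {ae P, forall w,
    (fun n : nat => avg_kernel_diff (@kernel1 R c d1)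
       (fun i : 'I_n => score_vec J1 (sample_cof S1 X1s n w (X1s i w)))
       (fun i : 'I_n => score_vec J1 (F1 (X1s i w)))) @ \oo --> (0 : R)} /\
  {ae P, forall w,
    (fun n : nat => avg_kernel_diff (@kernel2 R c d2)
       (fun i : 'I_n => score_vec J2 (sample_cof S2 X2s n w (X2s i w)))
       (fun i : 'I_n => score_vec J2 (F2 (X2s i w)))) @ \oo --> (0 : R)}.

Proof.
split.
- apply: (avg_kernel_diff_sample_cof_cvg0 (mu := distribution P X1)) => //.
  + exact: (iid_comp measurable_fst hX).
  + exact: (grid_sample_comp measurable_fst hS1).
  + exact: stable_kernel1.
- apply: (avg_kernel_diff_sample_cof_cvg0 (mu := distribution P X2)) => //.
  + exact: (iid_comp measurable_snd hX).
  + exact: (grid_sample_comp measurable_snd hS2).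
  + exact: stable_kernel2.
Qed.
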